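(* Let $T\in(0,\infty)$, $m\in\mathbb{N}$, $\varrho_0>0$, let $\tau:[0,\infty)\to(0,\infty)$ be continuous, let $\rho(t)=\exp\left(-\int_0^t\frac{1}{\tau(s)}\,ds\right)$ for $t\in(0,\infty)$, and let $h$ be a positive, decreasing function on $[0,T]$. Then $$\ell^{\varrho}(t):=\frac{[h(t)-h(T)]^m}{\int_0^T\rho^{-1}(s)\,[h(s)-h(T)]^m\,ds}\,\chi_{[0,T)}(t)\qquad\text{for } t\in[0,\infty)$$ is positive and decreasing on $[0,T]$, satisfies $(\ell^{\varrho})^{(j)}(T)=0$ for $j=0,1,\ldots,m-1$, and the solution $\varrho$ of the relaxation problem $$\tau\,\varrho'+\varrho=-\tau\,\varrho_0\,\ell^{\varrho}\ \text{ on }(0,\infty),\qquad \varrho(0)=\varrho_0,$$ stops at the time $T$. Moreover, $\varrho$ is $C^m$ on $(0,\infty)$.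
   Context: $\rho$ and $\varrho$ are different functions. $\rho^{-1}(s)=1/\rho(s)$, and $\chi_{[0,T)}$ is the indicator function of $[0,T)$. A process $u$ ''stops at the time $T$'' if $u(t)=0$ for all $t\ge T$.
   Formalization: Decreasing is read as strict, positive as on [0,T), m≥1. Added: h is C^{m-1} on (0,T] for the vanishing derivatives at T; h is continuous on (0,T] for the solution and its stopping; h is C^{m-1} on (0,T] and τ is C^{m-1} on (0,∞) for ϱ being C^m. False without: m=2, h=1+√(T−t). *)

(* Defs.v *)
From Stdlib Require Import Reals.
From Coquelicot Require Import Coquelicot.
Open Scope R_scope.

Definition strictly_decreasing_on (D : R -> Prop) (f : R -> R) : Prop :=
  forall s t : R, D s -> D t -> s < t -> f t < f s.

(** [C^k] on a set [D], meant for open [D]: the derivatives are two-sided. *)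
Definition Ck_on (k : nat) (D : R -> Prop) (f : R -> R) : Prop :=
  forall (j : nat) (t : R), (j <= k)%nat -> D t ->
    ex_derive_n f j t /\ continuous (Derive_n f j) t.

(** [C^k] on the half-open interval [(0, T]]: [f] is [C^k] in the interior and
    all derivatives up to order [k] have finite limits at the right endpoint,
    the limit of [f] itself being the value [f T].  Nothing is required of [f]
    at [0] or to the right of [T]. *)
Definition Ck_on_oc (k : nat) (T : R) (f : R -> R) : Prop :=
  Ck_on k (fun t => 0 < t < T) f /\
  filterlim f (at_left T) (locally (f T)) /\
  forall j : nat, (j <= k)%nat ->
    exists l : R, filterlim (Derive_n f j) (at_left T) (locally l).

Definition chi (T t : R) : R :=
  if Rle_dec 0 t then (if Rlt_dec t T then 1 else 0) else 0.

Definition rho (tau : R -> R) (t : R) : R :=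
  exp (- RInt (fun s => / tau s) 0 t).

Definition ell (tau h : R -> R) (m : nat) (T t : R) : R :=
  (h t - h T) ^ m / RInt (fun s => / rho tau s * (h s - h T) ^ m) 0 T * chi T t.

(** Classical solutions of [tau y' + y = - tau y0 l] on [(0, oo)] that attain
    the initial value [y0] continuously.  Values of [y] at negative times are
    irrelevant. *)
Definition relaxation_solution (tau l : R -> R) (y0 : R) (y : R -> R) : Prop :=
  continuous_on (fun t => 0 <= t) y /\
  y 0 = y0 /\
  forall t : R, 0 < t ->
    ex_derive y t /\ tau t * Derive y t + y t = - tau t * y0 * l t.

Definition stops_at (T : R) (u : R -> R) : Prop :=
  forall t : R, T <= t -> u t = 0.

(* Main.v *)
Require Import Defs.
From Stdlib Require Import Reals Lra Lia.
From Coquelicot Require Import Coquelicot.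
Open Scope R_scope.

(** Write E for the integrating factor exp (RInt (1 / tau) 0 t), which is
    1 / rho at nonnegative times.  The relaxation equation says that E y has
    derivative - y0 E l, so its only solution is
    y t = (y0 - y0 RInt (E l) 0 t) / E t ([relaxation_correct],
    [relaxation_unique]).  The denominator of [ell] is chosen so that E [ell]
    has integral 1 over [0, T] ([RInt_growth_ell]); the bracket thus vanishes at
    T, and it stays zero because [ell] does.

    Since [h] is only assumed monotone, integrability needs an argument: E
    increases and the powers of h - h T decrease, and a product of two such
    nonnegative functions is a difference of increasing ones
    ([ex_RInt_increasing_mult_decreasing]); increasing functions are squeezed
    between step functions on dyadic partitions ([increasing_sandwich]).
    Monotonicity also gives the positivity of the denominator
    ([normalization_pos]).

    Regularity is a matter of the point T.  Differentiating the m-th power of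
    g = h - h T at most m - 1 times leaves a factor g in every term, and the
    other factors are derivatives of h, which have limits; so all these
    derivatives tend to 0 from the left ([vanishing_power], [ell_flat]).  By the
    mean value theorem, a function that is extended by zero and whose derivative
    tends to 0 is differentiable at the junction with derivative 0
    ([is_derive_zero_extension]); iterating this, [ell] is flat to order m - 1 at
    T and is of class C^(m-1) on (0, oo) ([derive_n_zero_extension],
    [Ck_on_zero_extension]).  The equation
    y' = - y / tau - y0 l then raises the regularity of the solution to
    C^m ([relaxation_Ck]). *)

(** * Riemann integrability of products of monotone functions *)

(** The Riemann sums of u differ from those of phi by at most those of psi, and
    on fine partitions both of these are close to their integrals; hence the
    Riemann sums of u are Cauchy. *)
Lemma ex_RInt_squeeze (u : R -> R) (a b : R) :
  a < b ->
  (forall eps : R, 0 < eps -> exists phi psi : R -> R,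
     ex_RInt phi a b /\ ex_RInt psi a b /\
     (forall t, a <= t <= b -> Rabs (u t - phi t) <= psi t) /\
     RInt psi a b < eps) ->
  ex_RInt u a b.
Proof.
  intros Hab H.
  apply (proj1 (filterlim_locally_cauchy (U := R_CompleteNormedModule)
    (F := Riemann_fine a b)
    (fun ptd => scal (sign (b - a)) (Riemann_sum u ptd)))).
  intros eps.
  (* Three errors below eps / 8 (the sums of phi and psi, the integral of psi)
     put every fine Riemann sum of u within eps / 2 of RInt phi a b. *)
  destruct (H (eps / 8)) as (phi & psi & Hphi & Hpsi & Hle & Hint).
  { generalize (cond_pos eps); lra. }
  apply (RInt_correct (V := R_CompleteNormedModule)) in Hphi, Hpsi.
  assert (H8 : 0 < eps / 8) by (generalize (cond_pos eps); lra).
  assert (Hs : sign (b - a) = 1) by (apply sign_eq_1; lra).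
  assert (A : forall g : R -> R, is_RInt g a b (RInt g a b) ->
    Riemann_fine a b (fun ptd => Rabs (Riemann_sum g ptd - RInt g a b) < eps / 8)).
  { intros g Hg.
    generalize (proj1 (filterlim_locally _ _) Hg (mkposreal _ H8)).
    apply filter_imp. intros ptd Hp. rewrite Hs in Hp.
    replace (Riemann_sum g ptd) with (scal 1 (Riemann_sum g ptd)); [exact Hp|].
    exact (scal_one (Riemann_sum g ptd)). }
  assert (B : Riemann_fine a b (fun ptd =>
     Rabs (Riemann_sum u ptd - Riemann_sum phi ptd) <= Riemann_sum psi ptd)).
  { exists (mkposreal 1 Rlt_0_1). intros ptd _ (Hpt & Ha & Hb).
    rewrite Rmin_left in Ha by lra. rewrite Rmax_right in Hb by lra.
    generalize (Riemann_sum_minus u phi ptd). intros E.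
    change (minus (Riemann_sum u ptd) (Riemann_sum phi ptd))
      with (Riemann_sum u ptd - Riemann_sum phi ptd) in E.
    rewrite <- E.
    apply (Riemann_sum_norm (fun x => minus (u x) (phi x)) psi ptd Hpt).
    intros t [Ht1 Ht2]. apply Hle. rewrite <- Ha, <- Hb. split; [exact Ht1|exact Ht2]. }
  exists (fun ptd => Rabs (Riemann_sum u ptd - RInt phi a b) < eps / 2).
  split.
  - generalize (filter_and _ _ (A phi Hphi) (filter_and _ _ (A psi Hpsi) B)).
    apply filter_imp. intros ptd (H1 & H2 & H3).
    revert H1 H2 H3. unfold Rabs; repeat destruct Rcase_abs; lra.
  - intros p q Hp Hq. rewrite Hs.
    change (Rabs (1 * Riemann_sum u q - 1 * Riemann_sum u p) < eps).
    revert Hp Hq. unfold Rabs; repeat destruct Rcase_abs; lra.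
Qed.

Definition increasing_on (a b : R) (f : R -> R) : Prop :=
  forall s t : R, a <= s -> s <= t -> t <= b -> f s <= f t.

(** On one interval, approximating u by its left value costs at most the length
    times the increment of u.  Bisection halves the lengths while the increments
    of the two halves add up, so each bisection step halves the total cost. *)
Lemma increasing_sandwich (u : R -> R) (n : nat) : forall a b : R,
  a <= b -> increasing_on a b u ->
  exists phi psi : R -> R,
    ex_RInt phi a b /\ ex_RInt psi a b /\
    (forall t, a <= t <= b -> Rabs (u t - phi t) <= psi t) /\
    RInt psi a b <= (b - a) * (u b - u a) / 2 ^ n.
Proof.
  induction n as [|n IH]; intros a b Hab Hu.
  - exists (fun _ => u a), (fun _ => u b - u a).
    split; [apply ex_RInt_const|]. split; [apply ex_RInt_const|]. split.
    + intros t Ht.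
      assert (u a <= u t) by (apply Hu; lra).
      assert (u t <= u b) by (apply Hu; lra).
      apply Rabs_le; lra.
    + rewrite RInt_const. unfold scal; simpl; unfold mult; simpl. lra.
  - set (c := (a + b) / 2).
    assert (Hc : a <= c <= b) by (unfold c; lra).
    destruct (IH a c) as (p1 & q1 & Hp1 & Hq1 & L1 & I1); [lra| |].
    { intros s t ? ? ?; apply Hu; lra. }
    destruct (IH c b) as (p2 & q2 & Hp2 & Hq2 & L2 & I2); [lra| |].
    { intros s t ? ? ?; apply Hu; lra. }
    set (glue := fun f g : R -> R => fun t => if Rle_dec t c then f t else g t).
    assert (G1 : forall f g t, Rmin a c < t < Rmax a c -> f t = glue f g t).
    { intros f g t. rewrite Rmax_right by lra. intros Ht.
      unfold glue; destruct Rle_dec; [easy|lra]. }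
    assert (G2 : forall f g t, Rmin c b < t < Rmax c b -> g t = glue f g t).
    { intros f g t. rewrite Rmin_left by lra. intros Ht.
      unfold glue; destruct Rle_dec; [lra|easy]. }
    assert (E1 : forall f g, ex_RInt f a c -> ex_RInt (glue f g) a c).
    { intros f g. apply ex_RInt_ext, G1. }
    assert (E2 : forall f g, ex_RInt g c b -> ex_RInt (glue f g) c b).
    { intros f g. apply ex_RInt_ext, G2. }
    exists (glue p1 p2), (glue q1 q2).
    split; [apply ex_RInt_Chasles with c; auto|].
    split; [apply ex_RInt_Chasles with c; auto|].
    split.
    + intros t Ht. unfold glue; destruct Rle_dec; [apply L1|apply L2]; lra.
    + rewrite <- (RInt_Chasles (glue q1 q2) a c b) by auto.
      change (plus (RInt (glue q1 q2) a c) (RInt (glue q1 q2) c b))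
        with (RInt (glue q1 q2) a c + RInt (glue q1 q2) c b).
      rewrite <- (RInt_ext q1 _ a c (G1 q1 q2)).
      rewrite <- (RInt_ext q2 _ c b (G2 q1 q2)).
      replace ((b - a) * (u b - u a) / 2 ^ S n) with
        ((c - a) * (u c - u a) / 2 ^ n + (b - c) * (u b - u c) / 2 ^ n); [lra|].
      unfold c; simpl; field. apply pow_nonzero; lra.
Qed.

Lemma ex_RInt_increasing (u : R -> R) (a b : R) :
  a <= b -> increasing_on a b u -> ex_RInt u a b.
Proof.
  intros [Hab| ->] Hu; [|apply ex_RInt_point].
  apply ex_RInt_squeeze; [easy|]. intros eps Heps.
  set (V := (b - a) * (u b - u a)).
  assert (HV : 0 <= V).
  { apply Rmult_le_pos; [lra|]. generalize (Hu a b); lra. }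
  destruct (pow_lt_1_zero (/ 2)) with (y := eps / (V + 1)) as [n Hn].
  { rewrite Rabs_pos_eq; lra. }
  { apply Rdiv_lt_0_compat; lra. }
  destruct (increasing_sandwich u n a b) as (p & q & Hp & Hq & L & I); [lra|easy|].
  exists p, q. do 3 (split; [easy|]).
  apply Rle_lt_trans with (1 := I). fold V.
  specialize (Hn n (Nat.le_refl n)).
  assert (0 < (/2) ^ n) by (apply pow_lt; lra).
  rewrite Rabs_pos_eq in Hn by lra.
  unfold Rdiv. rewrite <- pow_inv.
  apply Rmult_lt_compat_r with (r := V + 1) in Hn; [|lra].
  replace (eps / (V + 1) * (V + 1)) with eps in Hn by (field; lra).
  nra.
Qed.

(** With M = f(a) g - g(b) f, both M and g f + M are increasing: for s <= t,
    g(t) f(t) - g(s) f(s) >= - g(b) (f(s) - f(t)), which M compensates. *)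
Lemma ex_RInt_increasing_mult_decreasing (g f : R -> R) (a b : R) :
  a <= b -> increasing_on a b g -> increasing_on a b (fun t => - f t) ->
  0 <= g a -> 0 <= f b ->
  ex_RInt (fun t => g t * f t) a b.
Proof.
  intros Hab Hg Hf Hg0 Hf0.
  set (M := fun t => f a * g t - g b * f t).
  apply ex_RInt_ext with (fun t => minus (g t * f t + M t) (M t)).
  { intros t _. unfold minus, plus, opp; simpl. ring. }
  apply (ex_RInt_minus (V := R_NormedModule)); apply ex_RInt_increasing; try easy;
    intros s t Hs Hst Ht; unfold M;
    generalize (Hg a s) (Hg s t) (Hg t b) (Hf a s) (Hf s t) (Hf t b);
    intros; nra.
Qed.

(** * Differentiability up to order k with limits along a filter *)

(** A single notion that covers both regularity classes involved: [Ck_on] is the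
    case of the filters [locally t] for t in D ([Ck_on_along]), and the one-sided
    condition of [Ck_on_oc] is the case of [at_left T].  The closure properties
    under sums, products and inverses are thus shared by both. *)
Definition Ck_along (k : nat) (D : R -> Prop) (F : (R -> Prop) -> Prop)
    (f : R -> R) : Prop :=
  forall j : nat, (j <= k)%nat ->
    (forall t, D t -> ex_derive_n f j t) /\
    exists l : R, filterlim (Derive_n f j) F (locally l).

Lemma filterlim_Rplus (F : (R -> Prop) -> Prop) (f g : R -> R) (l m : R) :
  Filter F -> filterlim f F (locally l) -> filterlim g F (locally m) ->
  filterlim (fun t => f t + g t) F (locally (l + m)).
Proof.
  intros HF Hf Hg. apply (filterlim_comp_2 _ _ _ Hf Hg).
  apply (filterlim_plus (V := R_NormedModule) l m).
Qed.

Lemma filterlim_Rmult (F : (R -> Prop) -> Prop) (f g : R -> R) (l m : R) :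
  Filter F -> filterlim f F (locally l) -> filterlim g F (locally m) ->
  filterlim (fun t => f t * g t) F (locally (l * m)).
Proof.
  intros HF Hf Hg. apply (filterlim_comp_2 _ _ _ Hf Hg).
  apply (filterlim_mult (K := R_AbsRing) l m).
Qed.

Lemma Derive_n_shift (f : R -> R) (j : nat) (t : R) :
  Derive_n (Derive f) j t = Derive_n f (S j) t.
Proof.
  change (Derive f) with (Derive_n f 1). rewrite Derive_n_comp.
  now rewrite Nat.add_1_r.
Qed.

Lemma ex_derive_n_shift (f : R -> R) (j : nat) (t : R) :
  ex_derive_n (Derive f) (S j) t <-> ex_derive_n f (S (S j)) t.
Proof.
  split; apply ex_derive_ext; intros s; [|symmetry]; apply Derive_n_shift.
Qed.

(** Peeling off the first derivative rather than the last one turns the Leibniz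
    and quotient rules into inductions on k. *)
Lemma Ck_along_S (k : nat) (D : R -> Prop) (F : (R -> Prop) -> Prop)
    (f : R -> R) (HF : Filter F) :
  Ck_along (S k) D F f <->
  (forall t, D t -> ex_derive f t) /\
  (exists l : R, filterlim f F (locally l)) /\
  Ck_along k D F (Derive f).
Proof.
  split.
  - intros H. split; [|split].
    + apply (H 1%nat); lia.
    + apply (H 0%nat); lia.
    + intros j Hj. destruct (H (S j)) as [H1 [l H2]]; [lia|]. split.
      * intros t Ht. destruct j as [|j]; [exact I|].
        apply (proj2 (ex_derive_n_shift f j t)), H1, Ht.
      * exists l. revert H2. apply filterlim_ext.
        intros t. symmetry. apply Derive_n_shift.
  - intros (H0 & H1 & H2) [|j] Hj.
    + split; [easy|exact H1].
    + destruct (H2 j) as [H3 [l H4]]; [lia|]. split.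
      * intros t Ht. destruct j as [|j]; [apply H0, Ht|].
        apply (proj1 (ex_derive_n_shift f j t)), H3, Ht.
      * exists l. revert H4. apply filterlim_ext.
        intros t. apply Derive_n_shift.
Qed.

Lemma Ck_along_0 (D : R -> Prop) (F : (R -> Prop) -> Prop) (f : R -> R) (l : R) :
  filterlim f F (locally l) -> Ck_along 0 D F f.
Proof.
  intros H j Hj. replace j with 0%nat by lia. split; [easy|].
  exists l. exact H.
Qed.

Lemma Ck_along_lim (k : nat) (D : R -> Prop) (F : (R -> Prop) -> Prop) (f : R -> R) :
  Ck_along k D F f -> exists l : R, filterlim f F (locally l).
Proof. intros H. apply (H 0%nat). lia. Qed.

Lemma Ck_along_le (k i : nat) (D : R -> Prop) (F : (R -> Prop) -> Prop)
    (f : R -> R) :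
  (i <= k)%nat -> Ck_along k D F f -> Ck_along i D F f.
Proof. intros Hi H j Hj. apply H. lia. Qed.

Lemma Ck_along_ext (k : nat) (D : R -> Prop) (F : (R -> Prop) -> Prop)
    (f g : R -> R) (HF : Filter F) :
  open D -> F D -> (forall t, D t -> f t = g t) ->
  Ck_along k D F f -> Ck_along k D F g.
Proof.
  intros HD HFD E H j Hj.
  assert (L : forall t, D t -> locally t (fun s => f s = g s)).
  { intros t Ht. apply filter_imp with (1 := E), HD, Ht. }
  destruct (H j Hj) as [H1 [l H2]]. split.
  - intros t Ht. apply ex_derive_n_ext_loc with f; auto.
  - exists l. apply filterlim_ext_loc with (2 := H2).
    apply filter_imp with (2 := HFD). intros t Ht.
    apply Derive_n_ext_loc, L, Ht.
Qed.

Lemma Ck_along_const (k : nat) (D : R -> Prop) (F : (R -> Prop) -> Prop) (c : R)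
    (HF : Filter F) : Ck_along k D F (fun _ => c).
Proof.
  revert c; induction k as [|k IH]; intros c.
  - apply Ck_along_0 with c. apply filterlim_const.
  - apply Ck_along_S; [easy|]. split; [|split].
    + intros t _. apply ex_derive_const.
    + exists c. apply filterlim_const.
    + intros j Hj. destruct (IH 0 j Hj) as [H1 [l H2]]. split.
      * intros t Ht. apply ex_derive_n_ext with (2 := H1 t Ht).
        intros s; symmetry; apply Derive_const.
      * exists l. revert H2. apply filterlim_ext. intros t.
        apply Derive_n_ext. intros s; symmetry; apply Derive_const.
Qed.

Lemma Ck_along_plus (k : nat) (D : R -> Prop) (F : (R -> Prop) -> Prop)
    (f g : R -> R) (HF : Filter F) :
  open D -> F D -> Ck_along k D F f -> Ck_along k D F g ->
  Ck_along k D F (fun t => f t + g t).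
Proof.
  intros HD HFD. revert f g. induction k as [|k IH]; intros f g Hf Hg.
  - apply Ck_along_lim in Hf as [l Hf], Hg as [m Hg].
    apply Ck_along_0 with (l + m). apply filterlim_Rplus; auto.
  - apply Ck_along_S in Hf as (Df & [l Lf] & Cf); [|easy].
    apply Ck_along_S in Hg as (Dg & [m Lg] & Cg); [|easy].
    apply Ck_along_S; [easy|]. split; [|split].
    + intros t Ht. apply (ex_derive_plus f g); auto.
    + exists (l + m). apply filterlim_Rplus; auto.
    + apply Ck_along_ext with (5 := IH _ _ Cf Cg); auto.
      intros t Ht. symmetry. apply Derive_plus; auto.
Qed.

Lemma Ck_along_mult (k : nat) (D : R -> Prop) (F : (R -> Prop) -> Prop)
    (f g : R -> R) (HF : Filter F) :
  open D -> F D -> Ck_along k D F f -> Ck_along k D F g ->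
  Ck_along k D F (fun t => f t * g t).
Proof.
  intros HD HFD. revert f g. induction k as [|k IH]; intros f g Hf Hg.
  - apply Ck_along_lim in Hf as [l Hf], Hg as [m Hg].
    apply Ck_along_0 with (l * m). apply filterlim_Rmult; auto.
  - assert (Hf' := Ck_along_le (S k) k _ _ _ (Nat.le_succ_diag_r k) Hf).
    assert (Hg' := Ck_along_le (S k) k _ _ _ (Nat.le_succ_diag_r k) Hg).
    apply Ck_along_S in Hf as (Df & [l Lf] & Cf); [|easy].
    apply Ck_along_S in Hg as (Dg & [m Lg] & Cg); [|easy].
    apply Ck_along_S; [easy|]. split; [|split].
    + intros t Ht. apply (ex_derive_mult f g); auto.
    + exists (l * m). apply filterlim_Rmult; auto.
    + apply Ck_along_ext with (fun t => Derive f t * g t + f t * Derive g t); auto.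
      * intros t Ht. symmetry. apply Derive_mult; auto.
      * apply Ck_along_plus; auto.
Qed.

Lemma Ck_along_inv (k : nat) (D : R -> Prop) (F : (R -> Prop) -> Prop)
    (f : R -> R) (l : R) (HF : Filter F) :
  open D -> F D -> (forall t, D t -> f t <> 0) -> l <> 0 ->
  filterlim f F (locally l) -> Ck_along k D F f ->
  Ck_along k D F (fun t => / f t).
Proof.
  intros HD HFD Hf0 Hl Lf.
  assert (L : filterlim (fun t => / f t) F (locally (/ l))).
  { apply filterlim_comp with (1 := Lf).
    apply (filterlim_Rbar_inv l). intros E. apply Hl. now injection E. }
  induction k as [|k IH]; intros Hf.
  - now apply Ck_along_0 with (/ l).
  - specialize (IH (Ck_along_le (S k) k _ _ _ (Nat.le_succ_diag_r k) Hf)).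
    apply Ck_along_S in Hf as (Df & _ & Cf); [|easy].
    apply Ck_along_S; [easy|]. split; [|split].
    + intros t Ht. apply ex_derive_inv; auto.
    + now exists (/ l).
    + apply Ck_along_ext with (fun t => - 1 * Derive f t * (/ f t * / f t)); auto.
      * intros t Ht. rewrite Derive_inv; auto. specialize (Hf0 t Ht). field; auto.
      * apply Ck_along_mult; auto; apply Ck_along_mult; auto.
        now apply Ck_along_const.
Qed.

(** Every neighbourhood of t contains t, so a limit along [locally t] can only be
    the value at t; existence of the limit is therefore continuity. *)
Lemma Ck_on_along (k : nat) (D : R -> Prop) (f : R -> R) :
  Ck_on k D f <-> forall t, D t -> Ck_along k D (locally t) f.
Proof.
  split.
  - intros H t Ht j Hj. split.
    + intros s Hs. now apply H.
    + exists (Derive_n f j t). now apply H.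
  - intros H j t Hj Ht. destruct (H t Ht j Hj) as [H1 [l H2]].
    split; [now apply H1|].
    assert (E : Derive_n f j t = l).
    { apply (filterlim_locally_unique (F := at_point t) (Derive_n f j)).
      - intros P HP. unfold filtermap, at_point. now apply locally_singleton.
      - intros P HP. apply (locally_singleton t (fun s => P (Derive_n f j s))), H2, HP. }
    unfold continuous. now rewrite E.
Qed.

(** * Powers of a function vanishing at the limit point *)

Lemma Ck_along_pow (k n : nat) (D : R -> Prop) (F : (R -> Prop) -> Prop)
    (f : R -> R) (HF : Filter F) :
  open D -> F D -> Ck_along k D F f -> Ck_along k D F (fun t => f t ^ n).
Proof.
  intros HD HFD Hf. induction n as [|n IH]; simpl.
  - now apply Ck_along_const.
  - now apply Ck_along_mult.
Qed.

(** The derivative of g^(k+2) p is g^(k+1) q with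
    q = (k+2) g' p + g p', which has the same form with one derivative and
    one factor g less; so the first k derivatives of g^(k+1) p all keep a
    factor g. *)
Lemma vanishing_power (k : nat) (D : R -> Prop) (F : (R -> Prop) -> Prop)
    (g p : R -> R) (HF : Filter F) :
  open D -> F D -> Ck_along k D F g -> filterlim g F (locally 0) ->
  Ck_along k D F p ->
  forall j, (j <= k)%nat ->
    filterlim (Derive_n (fun t => g t ^ S k * p t) j) F (locally 0).
Proof.
  intros HD HFD Hg Lg. revert p.
  (* Only the convergence of the cofactor g^n q matters here. *)
  assert (Z : forall n q, Ck_along 0 D F q ->
     filterlim (fun t => g t ^ S n * q t) F (locally 0)).
  { intros n q Hq.
    destruct (Ck_along_lim 0 D F (fun t => g t ^ n * q t)) as [l Hl].
    - apply Ck_along_mult; auto. apply Ck_along_pow; auto.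
      apply Ck_along_le with (2 := Hg); lia.
    - apply filterlim_ext with (fun t => g t * (g t ^ n * q t)).
      { intros t; simpl; ring. }
      replace 0 with (0 * l) by ring. apply filterlim_Rmult; auto. }
  induction k as [|k IH]; intros p Hp [|j] Hj; try lia.
  - now apply Z.
  - apply Z. apply Ck_along_le with (2 := Hp); lia.
  - assert (Hg' := Ck_along_le (S k) k _ _ _ (Nat.le_succ_diag_r k) Hg).
    assert (Hp' := Ck_along_le (S k) k _ _ _ (Nat.le_succ_diag_r k) Hp).
    apply Ck_along_S in Hg as (Dg & _ & Cg); [|easy].
    apply Ck_along_S in Hp as (Dp & _ & Cp); [|easy].
    set (q := fun t => INR (S (S k)) * (Derive g t * p t) + g t * Derive p t).
    assert (Hq : Ck_along k D F q).
    { apply Ck_along_plus; auto; apply Ck_along_mult; auto.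
      - now apply Ck_along_const.
      - apply Ck_along_mult; auto. }
    assert (jk : (j <= k)%nat) by lia.
    generalize (IH Hg' q Hq j jk). apply filterlim_ext_loc.
    apply filter_imp with (2 := HFD). intros t Ht. rewrite <- Derive_n_shift.
    apply Derive_n_ext_loc. generalize (HD t Ht). apply filter_imp.
    intros s Hs. rewrite Derive_mult; auto.
    + rewrite Derive_pow by auto. unfold q. simpl. ring.
    + apply (ex_derive_pow g); auto.
Qed.

(** * Extension by zero across an endpoint *)

Lemma continuous_zero_extension (f : R -> R) (T : R) :
  (forall t, T <= t -> f t = 0) -> filterlim f (at_left T) (locally 0) ->
  continuous f T.
Proof.
  intros Hz Hl. unfold continuous. rewrite (Hz T) by lra.
  apply filterlim_locally. intros eps.
  generalize (proj1 (filterlim_locally _ _) Hl eps).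
  unfold at_left, within. apply filter_imp. intros t Ht.
  destruct (Rlt_or_le t T) as [H|H]; [auto|].
  rewrite Hz by easy. apply ball_center.
Qed.

(** By the mean value theorem, a left difference quotient at T is a value of the
    derivative at a point at least as close to T, hence tends to 0. *)
Lemma is_derive_zero_extension (f : R -> R) (a T : R) :
  a < T -> (forall t, T <= t -> f t = 0) ->
  (forall t, a < t < T -> ex_derive f t) ->
  filterlim f (at_left T) (locally 0) ->
  filterlim (Derive f) (at_left T) (locally 0) ->
  is_derive f T 0.
Proof.
  intros HaT Hz Hd Hl Hl'.
  assert (HcT : continuous f T) by now apply continuous_zero_extension.
  apply is_derive_Reals. intros eps Heps.
  destruct (proj1 (filterlim_locally _ _) Hl' (mkposreal eps Heps)) as [d Hball].
  assert (Hd0 : 0 < Rmin d (T - a)).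
  { apply Rmin_pos; [apply cond_pos|lra]. }
  exists (mkposreal _ Hd0). simpl. intros k Hk0 Hk.
  assert (Hk1 := Rlt_le_trans _ _ _ Hk (Rmin_l _ _)).
  assert (Hk2 := Rlt_le_trans _ _ _ Hk (Rmin_r _ _)).
  rewrite (Hz T) by lra.
  destruct (Rlt_or_le k 0) as [Hneg|Hpos].
  2: { rewrite Hz by lra. replace ((0 - 0) / k - 0) with 0 by (field; easy).
       now rewrite Rabs_R0. }
  rewrite Rabs_left in Hk1, Hk2 by easy.
  (* The mean value theorem may return the endpoint T itself, where the
     derivative is what is being computed; df is given a harmless value there. *)
  set (df := fun t => if Rlt_dec t T then Derive f t else 0).
  destruct (MVT_gen f (T + k) T df) as (c & Hc & E).
  - intros t. rewrite Rmin_left, Rmax_right by lra. intros Ht. unfold df.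
    destruct Rlt_dec; [|lra]. apply Derive_correct, Hd. lra.
  - intros t. rewrite Rmin_left, Rmax_right by lra. intros Ht.
    apply continuity_pt_filterlim.
    destruct (Req_dec t T) as [->|Hn]; [exact HcT|].
    apply (ex_derive_continuous f), Hd. lra.
  - rewrite Rmin_left, Rmax_right in Hc by lra. rewrite (Hz T) in E by lra.
    replace ((f (T + k) - 0) / k - 0) with (df c).
    + unfold df. destruct Rlt_dec as [HcT'|]; [|now rewrite Rabs_R0].
      assert (B : ball T d c).
      { change (Rabs (c - T) < d). apply Rabs_def1; lra. }
      specialize (Hball c B HcT'). change (Rabs (Derive f c - 0) < eps) in Hball.
      now rewrite Rminus_0_r in Hball.
    + replace (f (T + k)) with (df c * k) by lra. field. easy.
Qed.

(** The vanishing on [T, oo) is carried through the induction because it is what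
    allows [is_derive_zero_extension] to be applied to the next derivative. *)
Lemma derive_n_zero_extension (f : R -> R) (a T : R) (k : nat) :
  a < T -> (forall t, T <= t -> f t = 0) ->
  (forall j t, (j <= k)%nat -> a < t < T -> ex_derive_n f j t) ->
  (forall j, (j <= k)%nat -> filterlim (Derive_n f j) (at_left T) (locally 0)) ->
  forall j, (j <= k)%nat ->
    is_derive_n f j T 0 /\ forall t, T <= t -> Derive_n f j t = 0.
Proof.
  intros HaT Hz Hd Hl. induction j as [|j IH]; intros Hj.
  - split; [apply Hz; lra|exact Hz].
  - destruct IH as [_ IHz]; [lia|].
    assert (HT : is_derive (Derive_n f j) T 0).
    { apply is_derive_zero_extension with a; auto.
      - intros t Ht. apply (Hd (S j) t); auto.
      - apply Hl; lia.
      - apply (Hl (S j)); lia. }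
    split; [exact HT|]. intros t [Ht|<-].
    + simpl. rewrite (Derive_ext_loc _ (fun _ => 0)).
      * apply Derive_const.
      * apply filter_imp with (2 := open_gt T t Ht). intros s Hs. apply IHz; lra.
    + now apply is_derive_unique.
Qed.

Lemma Ck_on_zero_extension (f : R -> R) (T : R) (k : nat) :
  0 < T -> (forall t, T <= t -> f t = 0) ->
  Ck_on k (fun t => 0 < t < T) f ->
  (forall j, (j <= k)%nat -> filterlim (Derive_n f j) (at_left T) (locally 0)) ->
  Ck_on k (fun t => 0 < t) f.
Proof.
  intros HT Hz Hd Hl j t Hj Ht.
  assert (X : forall i, (i <= k)%nat ->
    is_derive_n f i T 0 /\ forall t, T <= t -> Derive_n f i t = 0).
  { apply derive_n_zero_extension with 0; auto. intros i s Hi Hs. now apply Hd. }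
  destruct (Rtotal_order t T) as [Hlt|[->|Hgt]].
  - now apply Hd.
  - split.
    + destruct j as [|j]; [exact I|]. exists 0. exact (proj1 (X (S j) Hj)).
    + apply continuous_zero_extension; [exact (proj2 (X j Hj))|now apply Hl].
  - assert (L : forall i, (i <= k)%nat -> locally t (fun s => 0 = Derive_n f i s)).
    { intros i Hi. apply filter_imp with (2 := open_gt T t Hgt).
      intros s Hs. symmetry. apply X; [easy|lra]. }
    split.
    + destruct j as [|j]; [exact I|].
      apply (ex_derive_ext_loc (fun _ => 0)); [apply L; lia|apply ex_derive_const].
    + apply continuous_ext_loc with (fun _ => 0); [now apply L|apply continuous_const].
Qed.

(** * The relaxation equation *)

(** Functions of time are continuous on [0, oo) only in the one-sided sense at 0.
    Freezing them at their initial value for negative times makes them continuous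
    on the whole line, so that two-sided results apply. *)
Lemma continuous_extend_left (f : R -> R) :
  continuous_on (fun t => 0 <= t) f ->
  forall x, continuous (fun s => f (Rmax 0 s)) x.
Proof.
  intros Hf x. unfold continuous.
  apply filterlim_comp with (within (fun t => 0 <= t) (locally (Rmax 0 x))).
  2: apply Hf, Rmax_l.
  assert (C : continuous (fun s => Rmax 0 s) x).
  { apply continuous_ext with (fun s => (s + Rabs s) / 2).
    - intros s. unfold Rmax, Rabs. destruct Rle_dec, Rcase_abs; lra.
    - apply (continuous_scal_l (fun s => s + Rabs s) (/ 2)).
      apply (continuous_plus (fun s => s) Rabs).
      + apply continuous_id.
      + apply continuous_Rabs. }
  intros P HP. generalize (C _ HP). unfold filtermap.
  apply filter_imp. intros s Hs. apply Hs, Rmax_l.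
Qed.

(** The integrating factor, equal to 1 / rho on [0, oo) and, thanks to the frozen
    tau, differentiable on the whole line. *)
Definition growth (tau : R -> R) (t : R) : R :=
  exp (RInt (fun s => / tau (Rmax 0 s)) 0 t).

Lemma growth_rho (tau : R -> R) (t : R) : 0 <= t -> / rho tau t = growth tau t.
Proof.
  intros Ht. unfold rho, growth. rewrite exp_Ropp, Rinv_inv. f_equal.
  apply RInt_ext. intros s. rewrite Rmin_left by easy. intros Hs.
  rewrite Rmax_right by lra. reflexivity.
Qed.

Lemma growth_pos (tau : R -> R) (t : R) : 0 < growth tau t.
Proof. apply exp_pos. Qed.

Lemma is_derive_growth (tau : R -> R) :
  continuous_on (fun t => 0 <= t) tau -> (forall t, 0 <= t -> 0 < tau t) ->
  forall t, is_derive (growth tau) t (growth tau t / tau (Rmax 0 t)).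
Proof.
  intros Hc Hp t.
  assert (C : forall s, continuous (fun s => / tau (Rmax 0 s)) s).
  { intros s. apply (continuous_comp (fun s => tau (Rmax 0 s)) Rinv).
    - now apply continuous_extend_left.
    - apply (filterlim_Rbar_inv (tau (Rmax 0 s))).
      generalize (Hp (Rmax 0 s) (Rmax_l _ _)). intros H E. injection E. lra. }
  unfold growth, Rdiv. rewrite Rmult_comm.
  apply (is_derive_comp exp); [apply is_derive_exp|].
  apply is_derive_RInt with (f := fun s => / tau (Rmax 0 s)) (a := 0); [|apply C].
  apply filter_forall. intros z. apply (RInt_correct (V := R_CompleteNormedModule)).
  apply ex_RInt_continuous. intros; apply C.
Qed.

Lemma continuous_growth (tau : R -> R) :
  continuous_on (fun t => 0 <= t) tau -> (forall t, 0 <= t -> 0 < tau t) ->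
  forall t, continuous (growth tau) t.
Proof.
  intros Hc Hp t. apply (ex_derive_continuous (growth tau)).
  eexists. now apply is_derive_growth.
Qed.

Lemma is_derive_growth_mult (tau : R -> R) (f : R -> R) (t : R) :
  continuous_on (fun t => 0 <= t) tau -> (forall t, 0 <= t -> 0 < tau t) ->
  0 < t -> ex_derive f t ->
  is_derive (fun s => growth tau s * f s) t
    (growth tau t / tau t * (tau t * Derive f t + f t)).
Proof.
  intros Hc Hp Ht Hf.
  replace (growth tau t / tau t * (tau t * Derive f t + f t)) with
    (growth tau t / tau (Rmax 0 t) * f t + growth tau t * Derive f t).
  - apply (is_derive_mult (growth tau) f); [now apply is_derive_growth| |].
    + now apply Derive_correct.
    + intros; apply Rmult_comm.
  - rewrite Rmax_right by lra. field. specialize (Hp t); lra.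
Qed.

Lemma increasing_growth (tau : R -> R) :
  continuous_on (fun t => 0 <= t) tau -> (forall t, 0 <= t -> 0 < tau t) ->
  forall s t, s <= t -> growth tau s <= growth tau t.
Proof.
  intros Hc Hp s t Hst.
  destruct (MVT_gen (growth tau) s t (fun t => growth tau t / tau (Rmax 0 t)))
    as (c & _ & E).
  - intros; now apply is_derive_growth.
  - intros; apply continuity_pt_filterlim; now apply continuous_growth.
  - assert (0 <= growth tau c / tau (Rmax 0 c) * (t - s)); [|lra].
    apply Rmult_le_pos; [|lra]. apply Rlt_le, Rdiv_lt_0_compat.
    + apply growth_pos.
    + apply Hp, Rmax_l.
Qed.

(** The difference of two solutions times the integrating factor has derivative
    zero on (0, oo) and is continuous at 0, where it vanishes. *)
Lemma relaxation_unique (tau l : R -> R) (y0 : R) (y z : R -> R) :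
  continuous_on (fun t => 0 <= t) tau -> (forall t, 0 <= t -> 0 < tau t) ->
  relaxation_solution tau l y0 y -> relaxation_solution tau l y0 z ->
  forall t, 0 <= t -> y t = z t.
Proof.
  intros Hc Hp (Cy & Iy & Ey) (Cz & Iz & Ez) t Ht.
  set (w := fun s => growth tau s * (y (Rmax 0 s) - z (Rmax 0 s))).
  assert (E : w t - w 0 = 0 * (t - 0)).
  { destruct (MVT_gen w 0 t (fun _ => 0)) as (c & _ & E); [| |exact E].
    - rewrite Rmin_left by easy. intros s [Hs _].
      destruct (Ey s Hs) as [Dy Yy], (Ez s Hs) as [Dz Yz].
      apply is_derive_ext_loc with (fun s => growth tau s * (y s - z s)).
      { apply filter_imp with (2 := open_gt 0 s Hs). intros r Hr.
        unfold w. now rewrite Rmax_right by lra. }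
      replace 0 with
        (growth tau s / tau s * (tau s * Derive (fun r => y r - z r) s + (y s - z s))).
      + apply (is_derive_growth_mult tau (fun r => y r - z r)); auto.
        apply (ex_derive_minus y z); auto.
      + rewrite Derive_minus by auto.
        replace (tau s * (Derive y s - Derive z s) + (y s - z s)) with 0 by lra.
        ring.
    - intros s _. apply continuity_pt_filterlim. unfold w.
      apply (continuous_mult (growth tau)
        (fun s => y (Rmax 0 s) - z (Rmax 0 s))); [now apply continuous_growth|].
      apply (continuous_minus (fun s => y (Rmax 0 s)) (fun s => z (Rmax 0 s))).
      + now apply (continuous_extend_left y).
      + now apply (continuous_extend_left z). }
  unfold w in E. rewrite (Rmax_right 0 t), (Rmax_right 0 0), Iy, Iz in E by lra.
  generalize (growth_pos tau t). nra.
Qed.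

(** Variation of constants. *)
Definition relaxation (tau l : R -> R) (y0 t : R) : R :=
  / growth tau t * (y0 - y0 * RInt (fun s => growth tau s * l s) 0 t).

(** The integral is required to exist for negative upper bounds as well, which
    yields the continuity of the solution at 0 from a two-sided statement. *)
Lemma relaxation_correct (tau l : R -> R) (y0 : R) :
  continuous_on (fun t => 0 <= t) tau -> (forall t, 0 <= t -> 0 < tau t) ->
  (forall z, ex_RInt (fun s => growth tau s * l s) 0 z) ->
  (forall t, 0 < t -> continuous l t) ->
  relaxation_solution tau l y0 (relaxation tau l y0).
Proof.
  intros Hc Hp Hi Hl.
  set (J := RInt (fun s => growth tau s * l s) 0 : R -> R).
  assert (HJ : forall t, locally t
    (fun z => is_RInt (fun s => growth tau s * l s) 0 z (J z))).
  { intros t. apply filter_forall. intros z.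
    apply (RInt_correct (V := R_CompleteNormedModule)), Hi. }
  assert (CJ : forall t, continuous J t).
  { intros t. exact (continuous_RInt_1 (fun s => growth tau s * l s) 0 t J (HJ t)). }
  assert (Cinv : forall t, continuous (fun s => / growth tau s) t).
  { intros t. apply (continuous_comp (growth tau) Rinv).
    - now apply continuous_growth.
    - apply (filterlim_Rbar_inv (growth tau t)).
      generalize (growth_pos tau t). intros H E. injection E. lra. }
  split; [|split].
  - intros t _. apply (filterlim_filter_le_1 (F := locally t)).
    { apply (filter_le_within (F := locally t)). }
    apply (continuous_mult (fun s => / growth tau s) (fun s => y0 - y0 * J s)).
    + apply Cinv.
    + apply (continuous_minus (fun _ => y0) (fun s => y0 * J s)).
      * apply continuous_const.
      * apply (continuous_scal_r y0 J), CJ.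
  - unfold relaxation. rewrite RInt_point. unfold growth.
    rewrite RInt_point. unfold zero; simpl. rewrite exp_0. field.
  - intros t Ht.
    assert (Hg := growth_pos tau t).
    assert (DJ : is_derive J t (growth tau t * l t)).
    { apply (is_derive_RInt (fun s => growth tau s * l s) J 0 t); [apply HJ|].
      apply (continuous_mult (growth tau) l); [now apply continuous_growth|auto]. }
    assert (D : is_derive (relaxation tau l y0) t
      (- (growth tau t / tau t) / growth tau t ^ 2 * (y0 - y0 * J t)
         + / growth tau t * (0 - y0 * (growth tau t * l t)))).
    { apply (is_derive_mult (fun s => / growth tau s) (fun s => y0 - y0 * J s)).
      - apply is_derive_inv; [|lra].
        generalize (is_derive_growth tau Hc Hp t). now rewrite Rmax_right by lra.
      - apply (is_derive_minus (fun _ => y0) (fun s => y0 * J s)).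
        + apply (is_derive_const (V := R_NormedModule) y0).
        + now apply is_derive_scal.
      - intros; apply Rmult_comm. }
    split; [eexists; exact D|].
    rewrite (is_derive_unique _ _ _ D). unfold relaxation. fold (J t).
    field. specialize (Hp t). lra.
Qed.

(** Bootstrapping: if y is C^j with j <= k, then so is
    y' = - y / tau - y0 l, hence y is C^(j+1). *)
Lemma relaxation_Ck (k : nat) (tau l : R -> R) (y0 : R) (y : R -> R) :
  (forall t, 0 <= t -> 0 < tau t) ->
  Ck_on k (fun t => 0 < t) tau -> Ck_on k (fun t => 0 < t) l ->
  relaxation_solution tau l y0 y ->
  Ck_on (S k) (fun t => 0 < t) y.
Proof.
  intros Hp Htau Hl (_ & _ & Hy).
  assert (HD : open (fun t => 0 < t)) by apply open_gt.
  rewrite Ck_on_along in Htau, Hl |- *. intros t Ht.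
  assert (HF : Filter (locally t)) by apply locally_filter.
  assert (Lt : locally t (fun t => 0 < t)) by now apply HD.
  assert (Cy : filterlim y (locally t) (locally (y t))).
  { apply (ex_derive_continuous y). now apply Hy. }
  assert (B : forall j, (j <= S k)%nat -> Ck_along j (fun t => 0 < t) (locally t) y).
  { induction j as [|j IH]; intros Hj.
    - now apply Ck_along_0 with (y t).
    - apply Ck_along_S; [easy|]. split; [|split].
      + intros s Hs. now apply Hy.
      + now exists (y t).
      + apply Ck_along_ext with (fun s => -1 * (/ tau s * y s) + - y0 * l s); auto.
        * intros s Hs. destruct (Hy s Hs) as [_ E].
          assert (Hs' : 0 < tau s) by (apply Hp; lra).
          replace (y s) with (- tau s * y0 * l s - tau s * Derive y s) by lra.
          field. lra.
        * assert (Hj' : (j <= k)%nat) by lia.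
          apply Ck_along_plus; auto; apply Ck_along_mult; auto.
          -- now apply Ck_along_const.
          -- apply Ck_along_mult; auto.
             apply Ck_along_inv with (tau t); auto.
             ++ intros s Hs. specialize (Hp s); lra.
             ++ specialize (Hp t); lra.
             ++ destruct (proj2 (Ck_on_along k _ tau) Htau 0%nat t) as [_ C]; auto; lia.
             ++ apply Ck_along_le with k; auto.
          -- now apply Ck_along_const.
          -- apply Ck_along_le with k; auto. }
  now apply B.
Qed.

(** * The forcing term *)

Lemma pow_strict_incr (x y : R) (m : nat) :
  (1 <= m)%nat -> 0 <= x < y -> x ^ m < y ^ m.
Proof.
  destruct m as [|k]; [lia|]. intros _ [Hx Hxy]. simpl.
  apply Rle_lt_trans with (x * y ^ k).
  - apply Rmult_le_compat_l; [easy|]. apply pow_incr; lra.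
  - apply Rmult_lt_compat_r; [|easy]. apply pow_lt; lra.
Qed.

(** The denominator of [ell]. *)
Definition normalization (tau h : R -> R) (m : nat) (T : R) : R :=
  RInt (fun s => / rho tau s * (h s - h T) ^ m) 0 T.

Lemma strictly_decreasing_gap (h : R -> R) (T : R) :
  strictly_decreasing_on (fun t => 0 <= t <= T) h ->
  forall t, 0 <= t < T -> 0 < h t - h T.
Proof. intros H t Ht. generalize (H t T). lra. Qed.

Lemma gap_pow_decreasing (h : R -> R) (m : nat) (T : R) :
  strictly_decreasing_on (fun t => 0 <= t <= T) h ->
  increasing_on 0 T (fun t => - (h t - h T) ^ m).
Proof.
  intros Hh s t Hs Hst Ht. apply Ropp_le_contravar, pow_incr.
  assert (W : forall a b, 0 <= a -> a <= b -> b <= T -> h b <= h a).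
  { intros a b Ha [Hab| ->] Hb; [|lra]. apply Rlt_le, Hh; lra. }
  generalize (W s t Hs Hst Ht) (W t T). lra.
Qed.

Lemma ex_RInt_normalization (tau h : R -> R) (m : nat) (T : R) :
  0 < T ->
  continuous_on (fun t => 0 <= t) tau -> (forall t, 0 <= t -> 0 < tau t) ->
  strictly_decreasing_on (fun t => 0 <= t <= T) h ->
  ex_RInt (fun s => growth tau s * (h s - h T) ^ m) 0 T.
Proof.
  intros HT Hc Hp Hh. apply ex_RInt_increasing_mult_decreasing.
  - lra.
  - intros s t _ Hst _. now apply increasing_growth.
  - now apply gap_pow_decreasing.
  - apply Rlt_le, growth_pos.
  - apply pow_le; lra.
Qed.

Lemma normalization_growth (tau h : R -> R) (m : nat) (T : R) :
  0 < T ->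
  normalization tau h m T = RInt (fun s => growth tau s * (h s - h T) ^ m) 0 T.
Proof.
  intros HT. apply RInt_ext. intros s. rewrite Rmin_left by lra. intros Hs.
  now rewrite growth_rho by lra.
Qed.

(** On [0, T / 2] the integrand is at least its factors' values at 0 (for the
    increasing one) and at T / 2 (for the decreasing one), which are positive. *)
Lemma normalization_pos (tau h : R -> R) (m : nat) (T : R) :
  0 < T ->
  continuous_on (fun t => 0 <= t) tau -> (forall t, 0 <= t -> 0 < tau t) ->
  strictly_decreasing_on (fun t => 0 <= t <= T) h ->
  0 < normalization tau h m T.
Proof.
  intros HT Hc Hp Hh. rewrite normalization_growth by easy.
  assert (Hi := ex_RInt_normalization tau h m T HT Hc Hp Hh).
  set (w := fun s => growth tau s * (h s - h T) ^ m) in *.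
  set (c := growth tau 0 * (h (T / 2) - h T) ^ m).
  assert (Hc0 : 0 < c).
  { apply Rmult_lt_0_compat; [apply growth_pos|].
    apply pow_lt, strictly_decreasing_gap; [easy|lra]. }
  assert (H1 : ex_RInt w 0 (T / 2)).
  { apply (ex_RInt_Chasles_1 (V := R_CompleteNormedModule)) with T; [lra|easy]. }
  assert (H2 : ex_RInt w (T / 2) T).
  { apply (ex_RInt_Chasles_2 (V := R_CompleteNormedModule)) with 0; [lra|easy]. }
  rewrite <- (RInt_Chasles w 0 (T / 2) T H1 H2).
  change (0 < RInt w 0 (T / 2) + RInt w (T / 2) T).
  assert (G1 : RInt (fun _ => c) 0 (T / 2) <= RInt w 0 (T / 2)).
  { apply RInt_le; [lra|apply ex_RInt_const|easy|]. intros s Hs.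
    apply Rmult_le_compat.
    - apply Rlt_le, growth_pos.
    - apply pow_le, Rlt_le, strictly_decreasing_gap; [easy|lra].
    - apply increasing_growth; auto; lra.
    - apply Ropp_le_cancel, (gap_pow_decreasing h m T Hh s (T / 2)); lra. }
  assert (G2 : 0 <= RInt w (T / 2) T).
  { apply RInt_ge_0; [lra|easy|]. intros s Hs.
    apply Rmult_le_pos; [apply Rlt_le, growth_pos|].
    apply pow_le, Rlt_le, strictly_decreasing_gap; [easy|lra]. }
  rewrite RInt_const in G1. change (scal (T / 2 - 0) c) with ((T / 2 - 0) * c) in G1.
  nra.
Qed.

Lemma ell_before (tau h : R -> R) (m : nat) (T t : R) :
  0 <= t < T -> ell tau h m T t = (h t - h T) ^ m / normalization tau h m T.
Proof.
  intros Ht. unfold ell, chi. fold (normalization tau h m T).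
  destruct Rle_dec; [destruct Rlt_dec; [ring|]|]; lra.
Qed.

Lemma ell_after (tau h : R -> R) (m : nat) (T t : R) :
  T <= t -> ell tau h m T t = 0.
Proof.
  intros Ht. unfold ell, chi. destruct Rle_dec; [destruct Rlt_dec|]; lra.
Qed.

Lemma ell_negative_time (tau h : R -> R) (m : nat) (T t : R) :
  t < 0 -> ell tau h m T t = 0.
Proof. intros Ht. unfold ell, chi. destruct Rle_dec; lra. Qed.

Lemma ell_pos (tau h : R -> R) (m : nat) (T : R) :
  0 < normalization tau h m T ->
  strictly_decreasing_on (fun t => 0 <= t <= T) h ->
  forall t, 0 <= t < T -> 0 < ell tau h m T t.
Proof.
  intros HN Hh t Ht. rewrite ell_before by easy.
  apply Rdiv_lt_0_compat; [|easy]. apply pow_lt. now apply strictly_decreasing_gap.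
Qed.

Lemma ell_strictly_decreasing (tau h : R -> R) (m : nat) (T : R) :
  (1 <= m)%nat -> 0 < normalization tau h m T ->
  strictly_decreasing_on (fun t => 0 <= t <= T) h ->
  strictly_decreasing_on (fun t => 0 <= t <= T) (ell tau h m T).
Proof.
  intros Hm HN Hh s t Hs Ht Hst.
  destruct (Rlt_or_le t T) as [HtT|HtT].
  - rewrite !ell_before by lra. apply Rmult_lt_compat_r.
    + now apply Rinv_0_lt_compat.
    + apply pow_strict_incr; [easy|].
      generalize (strictly_decreasing_gap h T Hh t) (Hh s t Hs Ht Hst). lra.
  - rewrite (ell_after _ _ _ _ t) by easy. apply ell_pos; [easy|easy|lra].
Qed.

(** [ell] is nonnegative and decreasing on all of [0, oo), so the monotone product
    criterion applies there; for negative z the integrand is zero. *)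
Lemma ex_RInt_growth_ell (tau h : R -> R) (m : nat) (T : R) :
  (1 <= m)%nat -> 0 < T -> 0 < normalization tau h m T ->
  continuous_on (fun t => 0 <= t) tau -> (forall t, 0 <= t -> 0 < tau t) ->
  strictly_decreasing_on (fun t => 0 <= t <= T) h ->
  forall z, ex_RInt (fun s => growth tau s * ell tau h m T s) 0 z.
Proof.
  intros Hm HT HN Hc Hp Hh z. destruct (Rlt_or_le z 0) as [Hz|Hz].
  - apply ex_RInt_ext with (fun _ => 0); [|apply ex_RInt_const].
    intros s. rewrite Rmin_right, Rmax_left by lra. intros Hs.
    rewrite ell_negative_time by lra. symmetry. apply Rmult_0_r.
  - assert (Hn : forall t, 0 <= t -> 0 <= ell tau h m T t).
    { intros t Ht. destruct (Rlt_or_le t T) as [HtT|HtT].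
      - apply Rlt_le, ell_pos; auto.
      - rewrite ell_after by easy. lra. }
    apply ex_RInt_increasing_mult_decreasing; auto.
    + intros s t _ Hst _. now apply increasing_growth.
    + intros s t Hs [Hst| ->] _; [|lra]. apply Ropp_le_contravar.
      destruct (Rlt_or_le t T) as [HtT|HtT].
      * apply Rlt_le, ell_strictly_decreasing; auto; lra.
      * rewrite (ell_after _ _ _ _ t) by easy. auto.
    + apply Rlt_le, growth_pos.
Qed.

Lemma RInt_growth_ell (tau h : R -> R) (m : nat) (T : R) :
  (1 <= m)%nat -> 0 < T ->
  continuous_on (fun t => 0 <= t) tau -> (forall t, 0 <= t -> 0 < tau t) ->
  strictly_decreasing_on (fun t => 0 <= t <= T) h ->
  forall t, T <= t -> RInt (fun s => growth tau s * ell tau h m T s) 0 t = 1.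
Proof.
  intros Hm HT Hc Hp Hh t Ht.
  assert (HN := normalization_pos tau h m T HT Hc Hp Hh).
  set (N := normalization tau h m T) in *.
  set (w := fun s => growth tau s * (h s - h T) ^ m).
  set (v := fun s => growth tau s * ell tau h m T s).
  assert (E1 : RInt v 0 T = 1).
  { rewrite <- (RInt_ext (fun s => scal (/ N) (w s)) v).
    - rewrite (RInt_scal (V := R_CompleteNormedModule)) by
        now apply ex_RInt_normalization.
      unfold w. rewrite <- normalization_growth by easy. fold N.
      change (/ N * N = 1). field. lra.
    - intros s. rewrite Rmin_left, Rmax_right by lra. intros Hs.
      unfold v. rewrite ell_before by lra. fold N.
      change (/ N * w s = growth tau s * ((h s - h T) ^ m / N)). unfold w. field. lra. }
  assert (Z : forall s, Rmin T t < s < Rmax T t -> 0 = v s).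
  { intros s. rewrite Rmin_left by lra. intros Hs. unfold v.
    rewrite ell_after by lra. ring. }
  assert (I1 : ex_RInt v 0 T) by now apply ex_RInt_growth_ell.
  assert (I2 : ex_RInt v T t).
  { apply ex_RInt_ext with (1 := Z). apply ex_RInt_const. }
  rewrite <- (RInt_Chasles v 0 T t I1 I2), E1.
  rewrite <- (RInt_ext (fun _ => 0) v T t Z), RInt_const.
  change (1 + (t - T) * 0 = 1). ring.
Qed.

Lemma ell_lim_at_left (tau h : R -> R) (m : nat) (T : R) :
  0 < T -> (1 <= m)%nat -> filterlim h (at_left T) (locally (h T)) ->
  filterlim (ell tau h m T) (at_left T) (locally 0).
Proof.
  intros HT Hm Hh.
  set (N := normalization tau h m T).
  assert (P : forall n, filterlim (fun t => (h t - h T) ^ n) (at_left T)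
      (locally ((h T - h T) ^ n))).
  { induction n as [|n IH]; simpl; [apply filterlim_const|].
    apply filterlim_Rmult; auto; try apply at_left_proper_filter.
    apply filterlim_Rplus; auto; try apply at_left_proper_filter.
    apply filterlim_const. }
  apply filterlim_ext_loc with (fun t => (h t - h T) ^ m * / N).
  - unfold at_left, within. generalize (open_gt 0 T HT). apply filter_imp.
    intros t Ht HtT. rewrite ell_before by lra. reflexivity.
  - replace 0 with ((h T - h T) ^ m * / N).
    + apply filterlim_Rmult; auto; [apply at_left_proper_filter|].
      apply filterlim_const.
    + rewrite Rminus_diag, pow_i by lia. ring.
Qed.

Lemma ell_continuous (tau h : R -> R) (m : nat) (T : R) :
  0 < T -> (1 <= m)%nat -> continuous_on (fun t => 0 < t <= T) h ->
  forall t, 0 < t -> continuous (ell tau h m T) t.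
Proof.
  intros HT Hm Hh t Ht. destruct (Rtotal_order t T) as [Hlt|[->|Hgt]].
  - assert (L : locally t (fun s => 0 < s < T)).
    { apply (open_and _ _ (open_gt 0) (open_lt T)). lra. }
    apply continuous_ext_loc with
      (fun s => (h s - h T) ^ m * / normalization tau h m T).
    { generalize L. apply filter_imp. intros s Hs. rewrite ell_before by lra.
      reflexivity. }
    assert (Ch : continuous h t).
    { intros P HP. assert (Ht' : 0 < t <= T) by lra. generalize (Hh t Ht' P HP).
      unfold filtermap, within. intros Q. generalize (filter_and _ _ L Q).
      apply filter_imp. intros s [Hs1 Hs2]. apply Hs2. lra. }
    assert (Cp : forall n, continuous (fun s => (h s - h T) ^ n) t).
    { induction n as [|n IH]; simpl; [apply continuous_const|].
      apply (continuous_mult (fun s => h s - h T) (fun s => (h s - h T) ^ n)); auto.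
      apply (continuous_minus h (fun _ => h T)); auto. apply continuous_const. }
    apply (continuous_mult (fun s => (h s - h T) ^ m)); auto. apply continuous_const.
  - apply continuous_zero_extension; [intros; now apply ell_after|].
    apply ell_lim_at_left; auto. intros P HP.
    assert (HT' : 0 < T <= T) by lra. generalize (Hh T HT' P HP).
    unfold filtermap, at_left, within. intros Q.
    generalize (filter_and _ _ (open_gt 0 T HT) Q). apply filter_imp.
    intros s [Hs1 Hs2] Hs3. apply Hs2. lra.
  - apply continuous_ext_loc with (fun _ => 0); [|apply continuous_const].
    generalize (open_gt T t Hgt). apply filter_imp. intros s Hs.
    rewrite ell_after by lra. reflexivity.
Qed.

(** Near T the forcing term is a constant multiple of the (k+1)-st power of
    h - h T, which vanishes at T: the situation of [vanishing_power]. *)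
Lemma ell_flat (tau h : R -> R) (k : nat) (T : R) :
  0 < T -> Ck_on_oc k T h ->
  Ck_on k (fun t => 0 < t < T) (ell tau h (S k) T) /\
  forall j, (j <= k)%nat ->
    filterlim (Derive_n (ell tau h (S k) T) j) (at_left T) (locally 0).
Proof.
  intros HT (Hin & Hlim & Hder).
  (* Written as a sum so that the closure lemma for sums applies. *)
  set (D := fun t => 0 < t < T). set (g := fun t => h t + - h T).
  set (p := fun _ : R => / normalization tau h (S k) T).
  assert (HD : open D) by apply (open_and _ _ (open_gt 0) (open_lt T)).
  assert (HF : Filter (at_left T)) by apply at_left_proper_filter.
  assert (HFD : at_left T D).
  { unfold at_left, within. apply filter_imp with (2 := open_gt 0 T HT).
    intros s Hs1 Hs2. split; assumption. }
  assert (Hg : forall F, Filter F -> F D -> Ck_along k D F h -> Ck_along k D F g).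
  { intros F fF FD Ch. apply Ck_along_plus; auto. now apply Ck_along_const. }
  assert (E : forall t, D t -> g t ^ S k * p t = ell tau h (S k) T t).
  { intros t [Ht1 Ht2]. rewrite ell_before by lra. reflexivity. }
  assert (Ch : Ck_along k D (at_left T) h).
  { intros j Hj. split; [|now apply Hder]. intros t Ht. now apply Hin. }
  split.
  - apply Ck_on_along. intros t Ht.
    assert (Lt : locally t D) by now apply HD.
    assert (Ft : Filter (locally t)) by apply locally_filter.
    apply Ck_along_ext with (fun t => g t ^ S k * p t); auto.
    assert (Cg : Ck_along k D (locally t) g).
    { apply Hg; [easy|easy|]. now apply (proj1 (Ck_on_along k D h)). }
    exact (Ck_along_mult k D (locally t) (fun t => g t ^ S k) p Ft HD Lt
      (Ck_along_pow k (S k) D (locally t) g Ft HD Lt Cg)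
      (Ck_along_const k D (locally t) _ Ft)).
  - intros j Hj.
    assert (V : filterlim (Derive_n (fun t => g t ^ S k * p t) j) (at_left T) (locally 0)).
    { apply vanishing_power with D; auto.
      - replace 0 with (h T + - h T) by ring.
        apply filterlim_Rplus; auto. apply filterlim_const.
      - exact (Ck_along_const k D (at_left T) _ HF). }
    apply filterlim_ext_loc with (2 := V). apply filter_imp with (2 := HFD).
    intros t Ht. apply Derive_n_ext_loc.
    apply filter_imp with (2 := HD t Ht). exact E.
Qed.

Theorem corollary2 (T : R) (m : nat) (varrho0 : R) (tau h : R -> R)
  (T_pos : 0 < T) (m_pos : (1 <= m)%nat) (varrho0_pos : 0 < varrho0)
  (tau_cont : continuous_on (fun t => 0 <= t) tau)
  (tau_pos : forall t : R, 0 <= t -> 0 < tau t)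
  (h_pos : forall t : R, 0 <= t <= T -> 0 < h t)
  (h_decr : strictly_decreasing_on (fun t => 0 <= t <= T) h) :
  (forall t : R, 0 <= t < T -> 0 < ell tau h m T t) /\
  strictly_decreasing_on (fun t => 0 <= t <= T) (ell tau h m T) /\
  (Ck_on_oc (m - 1) T h ->
     forall j : nat, (j <= m - 1)%nat -> is_derive_n (ell tau h m T) j T 0) /\
  (continuous_on (fun t => 0 < t <= T) h ->
     exists varrho : R -> R,
       relaxation_solution tau (ell tau h m T) varrho0 varrho /\
       (forall y : R -> R,
          relaxation_solution tau (ell tau h m T) varrho0 y ->
          forall t : R, 0 <= t -> y t = varrho t) /\
       stops_at T varrho /\
       (Ck_on_oc (m - 1) T h ->
        Ck_on (m - 1) (fun t => 0 < t) tau ->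
        Ck_on m (fun t => 0 < t) varrho)).
Proof.
  assert (HN : 0 < normalization tau h m T) by now apply normalization_pos.
  destruct m as [|k]; [lia|]. replace (S k - 1)%nat with k by lia.
  assert (Hz : forall t, T <= t -> ell tau h (S k) T t = 0).
  { intros t Ht. now apply ell_after. }
  split; [|split; [|split]].
  - now apply ell_pos.
  - now apply ell_strictly_decreasing.
  - intros Hh j Hj. destruct (ell_flat tau h k T T_pos Hh) as [Hin Hlim].
    apply (derive_n_zero_extension (ell tau h (S k) T) 0 T k); auto.
    intros i t Hi Ht. now apply Hin.
  - intros h_cont.
    assert (Hsol : relaxation_solution tau (ell tau h (S k) T) varrho0
      (relaxation tau (ell tau h (S k) T) varrho0)).
    { apply relaxation_correct; auto.
      - now apply ex_RInt_growth_ell.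
      - now apply ell_continuous. }
    exists (relaxation tau (ell tau h (S k) T) varrho0).
    split; [exact Hsol|]. split; [|split].
    + intros y Hy. now apply relaxation_unique with (3 := Hy).
    + intros t Ht. unfold relaxation. rewrite RInt_growth_ell by auto. ring.
    + intros Hh Htau. apply relaxation_Ck with (4 := Hsol); auto.
      destruct (ell_flat tau h k T T_pos Hh) as [Hin Hlim].
      now apply Ck_on_zero_extension with T.
Qed.
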